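(* Let $\mathbb{F}_q$ be a finite field, let $0<i<n$ be integers, let $b,c\in\mathbb{F}_q\setminus\{0\}$, and let $g(x)\in\mathbb{F}_q[x]$ be a monic polynomial dividing $x^n-bx^i-c$. Let $C$ be the polycyclic code of length $n$ over $\mathbb{F}_q$ associated with $x^n-bx^i-c$ and generated by $g(x)$. Then $C$ is self-dual if and only if there are a positive integer $k$ and an element $a\in\mathbb{F}_q$ such that $n=2k$, $i=k$, $g(x)=x^k-a$ (so that $x^k-a\mid x^{n}-bx^k-c$), $a^2=-1$, and $\operatorname{Ord}(x^n-bx^i-c)\geq 3k$. Moreover, whenever such a code $C$ is self-dual, its minimum distance is $2$ and $C$ is a constacyclic code.
   Context: Vectors $(c_0,\dots,c_{n-1})\in\mathbb{F}_q^n$ are identified with polynomials $c_0+c_1x+\cdots+c_{n-1}x^{n-1}$. For a monic polynomial $f(x)\in\mathbb{F}_q[x]$ of degree $n$ and a monic divisor $g(x)$ of $f(x)$, the polycyclic code associated with $f(x)$ and generated by $g(x)$ is the ideal $\langle g(x)\rangle$ of $\mathbb{F}_q[x]/\langle f(x)\rangle$, i.e. the set of all multiples of $g(x)$ of degree less than $n$, viewed as a linear code of length $n$. The dual $C^\perp$ is taken with respect to the Euclidean inner product; $C$ is self-dual if $C=C^\perp$. For a polynomial $f\in\mathbb{F}_q[x]$ with $f(0)\neq 0$, $\operatorname{Ord}(f)$ is the least positive integer $e$ such that $f(x)\mid x^e-1$. A linear code $C\subseteq\mathbb{F}_q^n$ is constacyclic if for some $\lambda\in\mathbb{F}_q$ one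 has $(\lambda v_{n-1},v_0,\dots,v_{n-2})\in C$ for every $(v_0,\dots,v_{n-1})\in C$. *)

(* Defs.v *)
From HB Require Import structures.
From mathcomp Require Import all_boot all_order all_fingroup all_algebra.

Set Implicit Arguments.
Unset Strict Implicit.
Unset Printing Implicit Defensive.

Import GRing.Theory.
Import Pdiv.CommonRing Pdiv.RingMonic.
Local Open Scope ring_scope.

Section Codes.
Variables (F : finFieldType) (n : nat).
Implicit Types (C : {set 'rV[F]_n}) (u v : 'rV[F]_n) (f g : {poly F}).

(* Meant for [f] monic with [size f = n.+1] and [1 < size f]; otherwise       *)
(* [{poly %/ f}] need not be the quotient by [f]. The vector [v] stands for   *)
(* the polynomial [rVpoly v = \sum_j v 0 j *: 'X^j].                          *)
Definition polycyclic_code f g : {set 'rV[F]_n} :=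
  [set v | [exists h : {poly %/ f},
              in_qpoly f (rVpoly v) == h * in_qpoly f g]].

Definition euclid_inner u v : F := \sum_(j < n) u 0 j * v 0 j.

Definition dual_code C : {set 'rV[F]_n} :=
  [set v | [forall u in C, euclid_inner u v == 0]].

Definition self_dual C : Prop := C = dual_code C.

Definition linear_code C : Prop := submod_closed (mem C).

Definition hamming_dist u v : nat := #|[set j | u 0 j != v 0 j]|.

(* Never holds when [C] has fewer than two words.                             *)
Definition has_min_distance C (d : nat) : Prop :=
  (exists u v, [/\ u \in C, v \in C, u != v & hamming_dist u v = d]) /\
  (forall u v, u \in C -> v \in C -> u != v -> (d <= hamming_dist u v)%N).

(* [ord_pred] is cyclic: it sends index 0 to [n.-1].                          *)
Definition consta_shift (lambda : F) v : 'rV[F]_n :=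
  \row_j (if j == 0 :> nat then lambda * v 0 (ord_pred j)
          else v 0 (ord_pred j)).

Definition constacyclic C : Prop :=
  linear_code C /\
  exists lambda : F, forall v, v \in C -> consta_shift lambda v \in C.

Lemma mem_polycyclic_code f g v :
    (0 < n)%N -> f \is monic -> size f = n.+1 -> g %| f ->
  (v \in polycyclic_code f g) = (g %| rVpoly v).
Proof.
move=> n_gt0 f_mon size_f g_dvd_f.
have mkE : mk_monic f = f by rewrite /mk_monic size_f ltnS n_gt0 f_mon.
rewrite inE; apply/existsP/idP => [[h /eqP] | /dvdpP[h Dv]].
  move/(congr1 (@polyn _ _)).
  move=> /=; move: (polyn h) => {}h; rewrite mkE rmodp_mulmr // => Ev.
  have mod_dvd p : g %| rmodp p f -> g %| p.
    by move=> g_dvd; rewrite (rdivp_eq f_mon p) dvdp_addr // dvdp_mull.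
  apply: mod_dvd; rewrite Ev.
  have -> : rmodp (h * g) f = h * g - rdivp (h * g) f * f.
    by rewrite [X in X - _](rdivp_eq f_mon) addrC addKr.
  by rewrite dvdp_sub ?dvdp_mulIr // dvdp_mull.
by exists (in_qpoly f h); rewrite -rmorphM Dv.
Qed.

End Codes.

Section PolyOrder.
Variables (F : finFieldType) (f : {poly F}).

Lemma poly_order_subproof :
  exists e, (0 < e)%N && ((f.[0] != 0) ==> (f %| 'X^e - 1)).
Proof.
have [f0 | f0] := eqVneq f.[0] 0; first by exists 1%N.
have nz_f : f != 0 by apply: contra_neq f0 => ->; rewrite horner0.
pose N := #|{: 'rV[F]_(size f)}|.
pose phi (e : 'I_N.+1) : 'rV[F]_(size f) := poly_rV ('X^e %% f).
have /injectivePn[e1 [e2 ne12 eq12]] : ~~ injectiveb phi.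
  apply/negP => /injectiveP /leq_card.
  by rewrite card_ord ltnn.
wlog lt12 : e1 e2 ne12 eq12 / (e1 < e2)%N => [IH|].
  have [|lt21|/val_inj/eqP] := ltngtP e1 e2; first exact: IH eq12.
    by apply: (IH e2 e1) => //; rewrite eq_sym.
  by rewrite (negPf ne12).
have modK p : rVpoly (poly_rV (p %% f) : 'rV_(size f)) = p %% f.
  by apply: poly_rV_K; apply: ltnW; rewrite ltn_modp.
have modE : 'X^e1 %% f = 'X^e2 %% f.
  by rewrite -[LHS]modK -[RHS]modK -/(phi _) eq12.
exists (e2 - e1)%N; rewrite subn_gt0 lt12 /=.
have cop : coprimep f 'X^e1.
  by rewrite coprimep_expr // -['X]subr0 -polyC0 coprimep_XsubC.
rewrite -(Gauss_dvdpr _ cop) mulrBr mulr1 -exprD subnKC 1?ltnW //.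
by rewrite /dvdp modpD modpN modE subrr.
Qed.

(* Junk value 1 when [f.[0] = 0].                                             *)
Definition poly_order : nat := ex_minn poly_order_subproof.

Lemma poly_orderP : f.[0] != 0 ->
  [/\ (0 < poly_order)%N, f %| 'X^poly_order - 1 &
      forall e, (0 < e)%N -> f %| 'X^e - 1 -> (poly_order <= e)%N].
Proof.
move=> f0; rewrite /poly_order; case: ex_minnP => m.
rewrite f0 /= => /andP[m_gt0 dvd_m] min_m; split=> // e e_gt0 dvd_e.
by rewrite min_m // e_gt0.
Qed.

End PolyOrder.

(* Main.v *)
(* Let [k] be the degree of [g] and [g*] its reciprocal. Up to a shift, the   *)
(* inner products of the generators [x^j g] are the coefficients of [g g*].   *)
(* So self-duality forces [n = 2k] and kills every coefficient of [g g*]      *)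
(* except the two extreme ones: [g g* = g(0) (x^n + 1)], and [g] divides      *)
(* [x^n + 1]. Then [g] divides both [b x^i + (c + 1)] and                     *)
(* [(c + 1) x^(n-i) - b], which are nonzero, hence [i = k] and                *)
(* [g = x^k - a]. The bound on the order is automatic because [b] is nonzero. *)
Require Import Defs.
From mathcomp Require Import all_boot all_order all_fingroup all_algebra.
From mathcomp Require Import zify ring.

Set Implicit Arguments.
Unset Strict Implicit.
Unset Printing Implicit Defensive.

Import GRing.Theory.
Local Open Scope ring_scope.

(** Necessity: orthogonality of the shifts [x^j g] kills every coefficient of [g g*] of index
    strictly between [2k - n] and [n] ([self_dual_recip_mul0]), and a dimension count gives
    [2k <= n] ([self_dual_deg_le]). As [g(0)] is nonzero, [n = 2k] and [g] divides [x^n + 1]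
    ([self_dual_deg]). Comparison with the trinomial leaves two nonzero binomials, of degree at most
    [i] and [n - i], both divisible by [g]; this forces [i = k] and the shape of [g]
    ([dvdp_trinomial_Xn_add1]).

    Sufficiency and the last two claims: a word lies in the code of [x^k - a] when each pair
    [(v_j, v_(j+k))] lies on the line spanned by [(-a, 1)] ([half_codeP]). So the code is a sum of
    [k] copies of that line, which is its own orthogonal in the plane because [a^2 = -1], and whose
    nonzero vectors have weight 2. *)

(** * Divisibility facts about trinomials and binomials *)

Section Trinomial.
Variables (F : fieldType) (n i : nat) (b c : F).
Hypotheses (i_gt0 : (0 < i)%N) (lt_in : (i < n)%N).

Let f : {poly F} := 'X^n - b *: 'X^i - c%:P.

Lemma size_trinomial : size f = n.+1.
Proof.
rewrite /f -addrA size_polyDl size_polyXn // ltnS.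
apply: (leq_trans (size_polyD _ _)); rewrite !size_polyN geq_max.
rewrite (leq_trans (size_scale_leq _ _)) ?size_polyXn //=.
by rewrite (leq_trans (size_polyC_leq1 _)) //; lia.
Qed.

Lemma trinomial_monic : f \is monic.
Proof.
rewrite monicE /lead_coef size_trinomial /= !coefE eqxx.
by rewrite (gtn_eqF lt_in) mulr0 subr0 gtn_eqF ?subr0 //; lia.
Qed.

Lemma trinomial0 : f.[0] = - c.
Proof.
rewrite horner_coef0 !coefE !(ltn_eqF i_gt0).
by rewrite (ltn_eqF (ltn_trans i_gt0 lt_in)) mulr0 !sub0r oppr0 add0r.
Qed.

End Trinomial.

(** One nonzero coefficient is enough here: in the application one of them is [b] or [-b], while
    [c + 1] is not known to be nonzero. *)
Lemma binomial_dvdp_size (F : fieldType) (g : {poly F}) (m : nat) (s t : F) :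
  (0 < m)%N -> (s != 0) || (t != 0) -> g %| s *: 'X^m + t%:P ->
  (size g <= m.+1)%N.
Proof.
move=> m_gt0 st0 /dvdp_leq.
have -> : s *: 'X^m + t%:P != 0.
  apply: contraL st0 => /eqP/polyP st0; rewrite negb_or !negbK.
  have := st0 0%N; have := st0 m; rewrite !coefE eqxx (gtn_eqF m_gt0).
  by rewrite eq_sym (gtn_eqF m_gt0) mulr1 mulr0 addr0 add0r => -> ->;
     rewrite eqxx.
move=> /(_ isT) /leq_trans; apply.
apply: (leq_trans (size_polyD _ _)); rewrite geq_max.
rewrite (leq_trans (size_scale_leq _ _)) ?size_polyXn //=.
by rewrite (leq_trans (size_polyC_leq1 _)).
Qed.

(** For [2k <= e < 3k], one division step on [x^e - 1] leaves [b x^(k+r) + c x^r - 1] with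
    [r = e - 2k < k]. Its degree is below [2k] and its coefficient [b] at [k + r] survives, so it is
    not a multiple of the trinomial. *)
Lemma dvdp_trinomial_Xn_sub1 (F : fieldType) (k e : nat) (b c : F) :
    (0 < k)%N -> b != 0 -> (0 < e)%N ->
  'X^(2 * k) - b *: 'X^k - c%:P %| 'X^e - 1 -> (3 * k <= e)%N.
Proof.
move=> k_gt0 b0 e_gt0 f_dvd; rewrite leqNgt; apply/negP => lt_e3k.
have size_f : size ('X^(2 * k) - b *: 'X^k - c%:P) = (2 * k).+1.
  by rewrite size_trinomial //; lia.
have le_e : (2 * k <= e)%N.
  have := dvdp_leq _ f_dvd; rewrite -size_poly_eq0 size_XnsubC // size_f.
  by move=> /(_ isT).
pose r := (e - 2 * k)%N.
have : 'X^(2 * k) - b *: 'X^k - c%:P %| b *: 'X^(k + r) + (c *: 'X^r - 1).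
  have -> : b *: 'X^(k + r) + (c *: 'X^r - 1) =
      ('X^e - 1) - 'X^r * ('X^(2 * k) - b *: 'X^k - c%:P).
    have -> : e = (r + 2 * k)%N by rewrite /r; lia.
    by rewrite !exprD -!mul_polyC; ring.
  by rewrite dvdp_sub // dvdp_mull.
move/dvdp_leq; rewrite size_f.
have -> : b *: 'X^(k + r) + (c *: 'X^r - 1) != 0.
  apply/eqP => /polyP/(_ (k + r)%N); rewrite !coefE eqxx.
  have [-> ->] : (k + r == r)%N = false /\ (k + r == 0)%N = false by lia.
  by rewrite mulr1 mulr0 subr0 addr0 => /eqP; rewrite (negPf b0).
move=> /(_ isT); apply/negP; rewrite -leqNgt.
apply: (leq_trans (size_polyD _ _)); rewrite geq_max.
rewrite (leq_trans (size_scale_leq _ _)) ?size_polyXn; last by lia.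
apply: (leq_trans (size_polyD _ _)); rewrite geq_max size_polyN size_poly1.
by rewrite (leq_trans (size_scale_leq _ _)) ?size_polyXn; lia.
Qed.

(** * Inner products of shifts as coefficients of [g g*] *)

Section Correlation.
Variables (F : finFieldType) (g : {poly F}) (k : nat).
Hypothesis size_g : size g = k.+1.

Definition recip_poly : {poly F} := \poly_(j < k.+1) g`_(k - j).

Lemma euclid_inner_shift n (j l : nat) :
    (j + k < n)%N -> (l + k < n)%N -> (j <= k + l)%N ->
  euclid_inner (poly_rV ('X^j * g) : 'rV_n) (poly_rV ('X^l * g)) =
  (g * recip_poly)`_(k + l - j).
Proof.
case: n => // n lt_jn lt_ln le_jkl.
(* With the length written [n.+1], padding by [x^(n-k-l)] moves the wanted coefficient to index [n].
   The convolution then pairs [t] with [n - t], where the padded reciprocal has the coefficient of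
   [x^l g] at [t]. *)
have -> : (g * recip_poly)`_(k + l - j) =
    (('X^j * g) * ('X^(n - k - l) * recip_poly))`_n.
  have -> : 'X^j * g * ('X^(n - k - l) * recip_poly) =
      'X^(j + (n - k - l)) * (g * recip_poly) by rewrite exprD; ring.
  by rewrite coefXnM ifF; [congr _`_ _|]; lia.
rewrite coefM; apply: eq_bigr => t _; rewrite !mxE; congr (_ * _).
have := ltn_ord t; rewrite !coefXnM coef_poly => lt_tn.
case: ltnP => lt_tl; case: ltnP => lt_nt //.
- by rewrite ifF //; lia.
- by apply: nth_default; rewrite size_g; lia.
by rewrite ifT; [congr _`_ _|]; lia.
Qed.

Lemma recip_mulE : g \is monic ->
    (forall m, (0 < m < 2 * k)%N -> (g * recip_poly)`_m = 0) -> (0 < k)%N ->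
  g * recip_poly = g`_0 *: ('X^(2 * k) + 1).
Proof.
move=> g_mon mid0 k_gt0.
have gk : g`_k = 1 by have /monicP := g_mon; rewrite /lead_coef size_g.
apply/polyP => m; rewrite !coefE.
have [->|m_gt0] := posnP m.
  rewrite coefM big_ord1 coef_poly /= !subn0 gk !mulr1.
  by rewrite ltn_eqF ?muln_gt0 // add0r mulr1.
rewrite mulr0n addr0.
have [lt_m2k|lt_2km|->] := ltngtP m (2 * k)%N.
- by rewrite mulr0 mid0 // m_gt0.
- rewrite mulr0; apply: nth_default.
  apply: (leq_trans (size_polyMleq _ _)); rewrite size_g.
  have := size_poly k.+1 (fun j => g`_(k - j)); rewrite -/recip_poly; lia.
have lt_k : (k < (2 * k).+1)%N by lia.
rewrite coefM (bigD1 (Ordinal lt_k)) //= big1 ?addr0.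
  by rewrite gk coef_poly mul2n -addnn addnK leqnn subnn mul1r mulr1.
move=> j; rewrite -val_eqE /= => ne_jk; rewrite coef_poly.
case: ltnP => [le_jk|]; last by rewrite mulr0.
by rewrite nth_default ?mul0r // size_g; lia.
Qed.

End Correlation.

(** * Constraints that self-duality puts on the generator *)

Section Code.
Variables (F : finFieldType) (n : nat) (f g : {poly F}).
Hypotheses (n_gt0 : (0 < n)%N) (f_mon : f \is monic) (size_f : size f = n.+1).
Hypotheses (g_dvd_f : g %| f).

Let C := polycyclic_code n f g.

Lemma polycyclic_shift_mem (j k : nat) : size g = k.+1 -> (j + k < n)%N ->
  poly_rV ('X^j * g) \in C.
Proof.
move=> size_g lt_n; rewrite mem_polycyclic_code //.
rewrite poly_rV_K ?dvdp_mull //.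
by apply: (leq_trans (size_polyMleq _ _)); rewrite size_polyXn size_g; lia.
Qed.

Lemma polycyclic_code_linear : linear_code C.
Proof.
have CE v : (v \in mem C) = (g %| rVpoly v) by exact: mem_polycyclic_code.
split=> [|x u v]; rewrite !CE.
  by rewrite linear0 dvdp0.
by move=> gu gv; rewrite linearP /= dvdp_add // -mul_polyC dvdp_mull.
Qed.

(* If [2k > n], some nonzero vector of degree less than [k] is orthogonal to  *)
(* the [n - k] generators, so it lies in [C] without being divisible by [g].  *)
Lemma self_dual_deg_le (k : nat) : size g = k.+1 -> self_dual C ->
  (2 * k <= n)%N.
Proof.
move=> size_g sdC; rewrite leqNgt; apply/negP => lt_n2k.
have le_kn : (k <= n)%N.
  have := dvdp_leq (monic_neq0 f_mon) g_dvd_f; rewrite size_f size_g; lia.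
pose A := \matrix_(t < k, j < n - k) ('X^j * g)`_t.
have : kermx A != 0.
  rewrite -mxrank_eq0 mxrank_ker.
  by have := rank_leq_col A; lia.
case/rowV0Pn=> w /sub_kermxP wA w0.
pose v : 'rV[F]_n := poly_rV (rVpoly w).
have vE : rVpoly v = rVpoly w.
  by apply: poly_rV_K; apply: (leq_trans (size_poly _ _)).
have : v \in C.
  rewrite sdC inE; apply/forall_inP => u.
  rewrite mem_polycyclic_code // => /dvdpP[h Du].
  have szh : (size h <= n - k)%N.
    have [->|h0] := eqVneq h 0; first by rewrite size_poly0.
    have : (size (rVpoly u) <= n)%N := size_poly _ _.
    have g0 : g != 0 by rewrite -size_poly_eq0 size_g.
    by rewrite Du size_mul // size_g addnS leq_subRL // addnC.
  rewrite -[u]rVpolyK Du /euclid_inner.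
  have expand (t : 'I_n) : poly_rV (h * g) 0 t * v 0 t =
      \sum_(j < size h) h`_j * (('X^j * g)`_t * (rVpoly w)`_t).
    rewrite !mxE -[in LHS](coefK h) poly_def mulr_suml coef_sum mulr_suml.
    by apply: eq_bigr => j _; rewrite -scalerAl coefZ mulrA.
  under eq_bigr do rewrite expand.
  rewrite exchange_big big1 //= => j _; rewrite -mulr_sumr.
  have lt_j : (j < n - k)%N := leq_trans (ltn_ord j) szh.
  have /rowP/(_ (Ordinal lt_j)) := wA; rewrite !mxE => wAj.
  rewrite (_ : \sum_(t < n) _ = 0) ?mulr0 // -[RHS]wAj.
  rewrite (bigID (fun t : 'I_n => (t < k)%N)) /= [X in _ + X]big1 ?addr0.
    rewrite (big_ord_narrow le_kn); apply: eq_bigr => t _.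
    by rewrite mxE coef_rVpoly_ord mulrC.
  move=> t; rewrite -leqNgt => le_kt.
  by rewrite [(rVpoly w)`_t]nth_default ?mulr0 // (leq_trans (size_poly _ _)).
rewrite mem_polycyclic_code // vE => /dvdp_leq; rewrite size_g.
have -> : rVpoly w != 0.
  by apply: contraNneq w0 => w0; rewrite -[w]rVpolyK w0 linear0.
by move=> /(_ isT); rewrite ltnNge size_poly.
Qed.

(** Shifts [j, l < n - k] stay in the code, and the index [k + l - j] then sweeps the whole range
    from [2k - n + 1] to [n - 1]. Taking [l = 0] or [j = 0] already reaches every index. *)
Lemma self_dual_recip_mul0 (k m : nat) : size g = k.+1 -> self_dual C ->
  (k < n)%N -> (k < m + (n - k))%N -> (m < n)%N -> (g * recip_poly g k)`_m = 0.
Proof.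
move=> size_g sdC lt_kn lt_km lt_mn.
have orth j l : (j + k < n)%N -> (l + k < n)%N -> (j <= k + l)%N ->
    (g * recip_poly g k)`_(k + l - j) = 0.
  move=> lt_j lt_l le_j; rewrite -(euclid_inner_shift size_g lt_j lt_l) //.
  have := polycyclic_shift_mem size_g lt_l; rewrite sdC inE.
  by move=> /forall_inP/(_ _ (polycyclic_shift_mem size_g lt_j))/eqP.
case: (leqP m k) => le_mk.
  by have := orth (k - m)%N 0%N; rewrite addn0 subKn //; apply; lia.
by have := orth 0%N (m - k)%N; rewrite subn0 subnKC; [apply|]; lia.
Qed.

End Code.

(** If [2k < n], the vanishing range would include index 0, where [g g*] has coefficient [g(0)]. *)
Lemma self_dual_deg (F : finFieldType) (n k : nat) (f g : {poly F}) :
    (0 < n)%N -> f \is monic -> size f = n.+1 -> g %| f -> g \is monic ->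
    g`_0 != 0 -> size g = k.+1 -> self_dual (polycyclic_code n f g) ->
  n = (2 * k)%N /\ g %| 'X^n + 1.
Proof.
move=> n_gt0 f_mon size_f g_dvd_f g_mon g0 size_g sdC.
have le_2kn := self_dual_deg_le n_gt0 f_mon size_f g_dvd_f size_g sdC.
have lt_kn : (k < n)%N by lia.
have mid0 m := @self_dual_recip_mul0 F n f g n_gt0 f_mon size_f g_dvd_f k m
  size_g sdC lt_kn.
have gk : g`_k = 1 by have /monicP := g_mon; rewrite /lead_coef size_g.
have le_n2k : (n <= 2 * k)%N.
  rewrite leqNgt; apply/negP => lt_2kn; have := mid0 0%N.
  rewrite coefM big_ord1 coef_poly /= !subn0 gk mulr1 => g00.
  by move: g0; rewrite g00 ?eqxx //; lia.
have n2k : n = (2 * k)%N by apply/eqP; rewrite eqn_leq le_n2k.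
split=> //; have k_gt0 : (0 < k)%N by lia.
have gg : g * recip_poly g k = g`_0 *: ('X^n + 1).
  by rewrite n2k; apply: recip_mulE => // m lt_m; apply: mid0; lia.
have : g %| g`_0 *: ('X^n + 1) by rewrite -gg dvdp_mulIl.
by rewrite dvdpZr.
Qed.

Lemma dvdp_trinomial_Xn_add1 (F : fieldType) (n i k : nat) (b c : F)
    (g : {poly F}) :
    (0 < i)%N -> (i < n)%N -> b != 0 -> n = (2 * k)%N -> size g = k.+1 ->
    g \is monic -> g %| 'X^n - b *: 'X^i - c%:P -> g %| 'X^n + 1 ->
  i = k /\ exists2 a, g = 'X^k - a%:P & a ^+ 2 = -1.
Proof.
move=> i_gt0 lt_in b0 n2k size_g g_mon g_dvd_f g_dvd1.
have g_dvd_i : g %| b *: 'X^i + (c + 1)%:P.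
  have -> : b *: 'X^i + (c + 1)%:P = ('X^n + 1) - ('X^n - b *: 'X^i - c%:P).
    by rewrite polyCD -!mul_polyC; ring.
  exact: dvdp_sub.
have g_dvd_ni : g %| (c + 1) *: 'X^(n - i) + (- b)%:P.
  have -> : (c + 1) *: 'X^(n - i) + (- b)%:P =
      'X^(n - i) * (b *: 'X^i + (c + 1)%:P) - b *: ('X^n + 1).
    rewrite -{3}(subnK (ltnW lt_in)) exprD polyCN !polyCD -!mul_polyC !polyCD.
    by ring.
  by rewrite dvdp_sub // ?dvdp_mull // -mul_polyC dvdp_mull.
have le_ki : (k <= i)%N.
  by have := binomial_dvdp_size i_gt0 _ g_dvd_i; rewrite size_g b0; apply.
have le_kni : (k <= n - i)%N.
  have := binomial_dvdp_size _ _ g_dvd_ni; rewrite size_g oppr_eq0 b0 orbT.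
  by apply; rewrite ?subn_gt0.
have ik : i = k by lia.
(* With [i = k], the binomial [b x^i + (c + 1)] has the same degree as [g], so [g] is its monic
   multiple; this dictates [a]. *)
split=> //; pose a := - ((c + 1) / b).
have k_gt0 : (0 < k)%N by lia.
have gE : g = 'X^k - a%:P.
  have size_Xa : size ('X^k - a%:P) = k.+1 by rewrite size_XnsubC.
  apply/eqP; rewrite -eqp_monic ?monicXnsubC //.
  rewrite -dvdp_size_eqp ?size_g ?size_Xa //.
  have -> : 'X^k - a%:P = b^-1 *: (b *: 'X^i + (c + 1)%:P).
    rewrite scalerDr scalerA mulVf // scale1r ik /a polyCN opprK.
    by rewrite mulrC -mul_polyC -polyCM.
  by rewrite -mul_polyC dvdp_mull.
exists a => //; apply/eqP; rewrite -addr_eq0; apply/negPn/negP => a2.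
have : g %| (a ^+ 2 + 1)%:P.
  have -> : (a ^+ 2 + 1)%:P = ('X^n + 1) - ('X^k + a%:P) * ('X^k - a%:P).
    by rewrite n2k mul2n -addnn exprD polyCD polyC_exp; ring.
  by rewrite dvdp_sub // -gE dvdp_mull.
by move/dvdp_leq; rewrite polyC_eq0 a2 size_g size_polyC a2; lia.
Qed.

(** Reducing with [x^k = a] folds the upper half of [p], scaled by [a], onto the lower half. *)
Lemma dvdp_XnsubCP (F : fieldType) (k : nat) (a : F) (p : {poly F}) :
    (0 < k)%N -> (size p <= 2 * k)%N ->
  reflect (forall j, (j < k)%N -> p`_j + a * p`_(j + k) = 0)
          ('X^k - a%:P %| p).
Proof.
move=> k_gt0 le_p2k; pose r := take_poly k p + a *: drop_poly k p.
have -> : ('X^k - a%:P %| p) = ('X^k - a%:P %| r).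
  rewrite -[p in LHS](poly_take_drop k).
  have -> : take_poly k p + drop_poly k p * 'X^k =
      r + drop_poly k p * ('X^k - a%:P) by rewrite /r -mul_polyC; ring.
  by rewrite dvdp_addl // dvdp_mull.
have coef_r j : (j < k)%N -> r`_j = p`_j + a * p`_(j + k).
  by move=> lt_jk; rewrite coefD coefZ coef_take_poly lt_jk coef_drop_poly.
have le_rk : (size r <= k)%N.
  apply: (leq_trans (size_polyD _ _)); rewrite geq_max size_take_poly.
  by rewrite (leq_trans (size_scale_leq _ _)) // size_drop_poly; lia.
apply: (iffP idP) => [dvd_r j lt_jk | r0].
  rewrite -coef_r // (_ : r = 0) ?coef0 //; apply/eqP.
  by apply: contraLR dvd_r => nz_r; rewrite gtNdvdp // size_XnsubC // ltnS.
rewrite (_ : r = 0) ?dvdp0 //; apply/polyP => j; rewrite coef0.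
have [lt_jk|le_kj] := ltnP j k; first by rewrite coef_r ?r0.
by rewrite nth_default // (leq_trans le_rk).
Qed.

(** * The code generated by [x^k - a] with [a^2 = -1] *)

Section HalfCode.
Variables (F : finFieldType) (k : nat) (a : F) (f : {poly F}).
Hypotheses (k_gt0 : (0 < k)%N) (a2 : a ^+ 2 = -1).
Hypotheses (f_mon : f \is monic) (size_f : size f = (2 * k).+1).
Hypothesis g_dvd_f : 'X^k - a%:P %| f.

Let C := polycyclic_code (2 * k) f ('X^k - a%:P).

Let a0 : a != 0.
Proof.
by apply/eqP => a0; move/eqP: a2; rewrite a0 expr0n eq_sym oppr_eq0 oner_eq0.
Qed.

Lemma half_codeP (v : 'rV[F]_(2 * k)) :
  reflect (forall j, (j < k)%N -> (rVpoly v)`_j + a * (rVpoly v)`_(j + k) = 0)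
          (v \in C).
Proof.
rewrite mem_polycyclic_code ?muln_gt0 //.
by apply: dvdp_XnsubCP => //; apply: size_poly.
Qed.

Lemma euclid_inner_half (u v : 'rV[F]_(2 * k)) :
  euclid_inner u v = \sum_(j < k) ((rVpoly u)`_j * (rVpoly v)`_j +
    (rVpoly u)`_(j + k) * (rVpoly v)`_(j + k)).
Proof.
have -> : euclid_inner u v =
    \sum_(0 <= j < 2 * k) (rVpoly u)`_j * (rVpoly v)`_j.
  by rewrite big_mkord; apply: eq_bigr => j _; rewrite !coef_rVpoly_ord.
move: (rVpoly u) (rVpoly v) => p q.
rewrite mul2n -addnn (big_cat_nat (n := k)) ?leq_addr //= big_split /=.
congr (_ + _); first by rewrite big_mkord.
by rewrite -{1}(add0n k) big_addn addnK big_mkord.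
Qed.

(** For two codewords, [u_j v_j = a^2 u_(j+k) v_(j+k)] cancels [u_(j+k) v_(j+k)]. Conversely,
    orthogonality to [x^j (x^k - a)] reads [v_(j+k) = a v_j], which times [a] is the membership
    equation. *)
Lemma half_code_self_dual : self_dual C.
Proof.
apply/setP => v; rewrite [RHS]inE.
apply/half_codeP/forall_inP => [Cv u Cu | Cv j lt_jk].
  rewrite euclid_inner_half big1 // => j _.
  have /eqP := Cv _ (ltn_ord j); have /half_codeP/(_ _ (ltn_ord j))/eqP := Cu.
  rewrite !addr_eq0 => /eqP-> /eqP->.
  by rewrite mulrNN mulrACA -expr2 a2 mulN1r addNr.
have lt_j2 : (j + k < 2 * k)%N by lia.
have := Cv _ (polycyclic_shift_mem _ f_mon size_f g_dvd_f
  (size_XnsubC a k_gt0) lt_j2).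
rewrite muln_gt0 k_gt0 => /(_ isT); rewrite euclid_inner_half.
rewrite poly_rV_K; last first.
  by rewrite (leq_trans (size_polyMleq _ _)) // size_polyXn size_XnsubC //; lia.
move: (rVpoly v) => p; have -> : 'X^j * ('X^k - a%:P) = 'X^(j + k) - a *: 'X^j.
  by rewrite exprD -mul_polyC; ring.
rewrite (bigD1 (Ordinal lt_jk)) //= big1 ?addr0 => [|t ne_tj]; last first.
  have {}ne_tj : (t == j :> nat) = false by exact/negbTE.
  have lt_tk := ltn_ord t; rewrite !coefE eqn_add2r ne_tj.
  have [-> ->] : (t == j + k :> nat)%N = false /\ (t + k == j)%N = false by lia.
  by rewrite !mulr0 subr0 !mul0r addr0.
rewrite !coefE !eqxx.
have [-> ->] : (j == j + k)%N = false /\ (j + k == j)%N = false by lia.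
rewrite mulr0 mulr1 sub0r subr0 mul1r mulNr => /eqP dual_j.
transitivity (a * (- (a * p`_j) + p`_(j + k))).
  by rewrite mulrDr mulrN mulrA -expr2 a2 mulN1r opprK.
by rewrite dual_j mulr0.
Qed.

(** The generator has weight 2. As [a] is nonzero, the entries [j] and [j + k] of a codeword vanish
    together, so no nonzero word has weight 1. *)
Lemma half_code_min_distance : has_min_distance C 2.
Proof.
have size_g := size_XnsubC a k_gt0.
have lin := polycyclic_code_linear _ f_mon size_f g_dvd_f.
have [C0 linC] : linear_code C by apply: lin; rewrite muln_gt0.
split.
  exists (poly_rV ('X^k - a%:P)), 0; split.
  - rewrite -['X^k - _]mul1r -[1](expr0 'X).
    by apply: polycyclic_shift_mem size_g _ => //; lia.
  - exact: C0.
  - apply/eqP => /(congr1 rVpoly).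
    rewrite linear0 poly_rV_K ?size_g; last by lia.
    by move/eqP; rewrite -size_poly_eq0 size_g.
  have lt0 : (0 < 2 * k)%N by lia.
  have ltk : (k < 2 * k)%N by lia.
  rewrite /hamming_dist (_ : [set _ | _] = [set Ordinal lt0; Ordinal ltk]).
    by rewrite cards2 -val_eqE /= ltn_eqF.
  apply/setP => j; rewrite !inE -!val_eqE !mxE /= !coefE.
  have [->|j0] := eqVneq (j : nat) 0%N.
    by rewrite ltn_eqF // sub0r oppr_eq0 a0.
  by rewrite subr0; case: (_ == k); rewrite ?oner_eq0 ?eqxx.
move=> u v Cu Cv ne_uv; pose w := u - v.
have Cw : w \in C.
  by have := linC (-1) v u Cv Cu; rewrite scaleN1r addrC.
have : w != 0 by rewrite subr_eq0.
have weightE : hamming_dist u v = #|[set j | w 0 j != 0]|.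
  by apply: eq_card => j; rewrite !inE !mxE subr_eq0.
rewrite {}weightE; move/half_codeP: Cw => Cw nz_w.
pose p := rVpoly w.
have nz_pair j : (j < k)%N -> (p`_j == 0) = (p`_(j + k) == 0).
  move/Cw/eqP; rewrite addr_eq0 => /eqP->.
  by rewrite oppr_eq0 mulf_eq0 (negPf a0).
have [t nz_t] : exists t, w 0 t != 0.
  by case/rV0Pn: nz_w => t; exists t.
have [j [lt_jk nz_j]] : exists j, (j < k)%N /\ p`_j != 0.
  have := ltn_ord t; move: nz_t; rewrite -coef_rVpoly_ord -/p.
  have [lt_tk nz_t _|le_kt nz_t lt_t2k] := ltnP t k; first by exists t.
  exists (t - k)%N; have lt_tk : (t - k < k)%N by lia.
  by rewrite nz_pair // subnK.
have lt_j : (j < 2 * k)%N by lia.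
have lt_jk2 : (j + k < 2 * k)%N by lia.
have card2 : #|[set Ordinal lt_j; Ordinal lt_jk2]| = 2%N.
  by rewrite cards2 -val_eqE /= (_ : (j == j + k)%N = false) //; lia.
rewrite -[leqLHS]card2; apply/subset_leq_card/subsetP => l.
rewrite !inE -coef_rVpoly_ord -/p.
by case/orP => /eqP-> //=; rewrite -?nz_pair.
Qed.

(* The twist is [-1]: the generator [x^k - a] divides [x^(2k) + 1].           *)
Lemma half_code_constacyclic : constacyclic C.
Proof.
split; first by apply: polycyclic_code_linear; rewrite ?muln_gt0.
exists (-1) => v /half_codeP Cv; apply/half_codeP => j lt_jk.
have coef_shift l : (l < 2 * k)%N -> (rVpoly (consta_shift (-1) v))`_l =
    if l == 0%N then - (rVpoly v)`_(2 * k).-1 else (rVpoly v)`_l.-1.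
  move=> lt_l.
  have /= -> := coef_rVpoly_ord (consta_shift (-1) v) (Ordinal lt_l).
  rewrite mxE /= -coef_rVpoly_ord /=.
  case: l lt_l => [|l] lt_l /=; rewrite ?mulN1r ?add0n.
    by rewrite modn_small //; lia.
  by rewrite modnDr modn_small //; lia.
rewrite !coef_shift; [|lia..].
have -> : (j + k == 0)%N = false by lia.
(* Away from the wraparound, the equation at [j + 1] is the old one at [j]. Only index 0 meets the
   twist and needs [a^2 = -1]. *)
case: j lt_jk => [|j] lt_jk /=; last by rewrite Cv // ltnW.
have lt_k1 : (k.-1 < k)%N by lia.
have := Cv _ lt_k1; have -> : (k.-1 + k = (2 * k).-1)%N by lia.
move/eqP; rewrite addr_eq0 add0n => /eqP->.
by rewrite mulrN mulrA -expr2 a2 mulN1r opprK addNr.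
Qed.

End HalfCode.

Unset Implicit Arguments.

(** * Assembly of the two directions *)

Theorem theorem5p1 (F : finFieldType) (n i : nat) (b c : F) (g : {poly F})
    (hi : (0 < i)%N) (hin : (i < n)%N) (hb : b != 0) (hc : c != 0)
    (hg : g \is monic) (hgf : g %| 'X^n - b *: 'X^i - c%:P) :
  let C := polycyclic_code n ('X^n - b *: 'X^i - c%:P) g in
  (self_dual C <->
   exists (k : nat) (a : F),
     [/\ (0 < k)%N, n = (2 * k)%N & i = k] /\
     [/\ g = 'X^k - a%:P,
         'X^k - a%:P %| 'X^n - b *: 'X^k - c%:P,
         a ^+ 2 = -1 &
         (3 * k <= poly_order ('X^n - b *: 'X^i - c%:P))%N])
  /\ (self_dual C -> has_min_distance C 2 /\ constacyclic C).
Proof.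
move=> C.
have n_gt0 : (0 < n)%N by apply: leq_trans hin.
have f_mon := trinomial_monic b c hi hin.
have size_f := size_trinomial b c hi hin.
have f0 := trinomial0 b c hi hin.
have g0 : g`_0 != 0.
  rewrite -horner_coef0; have /dvdpP[h Df] := hgf.
  have := hc; rewrite -oppr_eq0 -f0 Df hornerM mulf_eq0 negb_or.
  by case/andP.
have sd_form : self_dual C -> exists (k : nat) (a : F),
    [/\ (0 < k)%N, n = (2 * k)%N, i = k, g = 'X^k - a%:P & a ^+ 2 = -1].
  move=> sdC; pose k := (size g).-1.
  have size_g : size g = k.+1 by rewrite prednK // size_poly_gt0 monic_neq0.
  have [n2k g_dvd1] :=
    self_dual_deg n_gt0 f_mon size_f hgf hg g0 size_g sdC.
  have [ik [a gE a2]] :=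
    dvdp_trinomial_Xn_add1 hi hin hb n2k size_g hg hgf g_dvd1.
  by exists k, a; split=> //; rewrite -ik.
split; first split.
- case/sd_form=> k [a [k_gt0 n2k ik gE a2]]; exists k, a; split=> //.
  split=> //; first by rewrite -gE -ik.
  (* Since [c] is nonzero, [poly_order] is the genuine order and not its default value 1. *)
  have nz_f0 : ('X^n - b *: 'X^i - c%:P).[0] != 0 by rewrite f0 oppr_eq0.
  have [e_gt0 f_dvd _] := poly_orderP nz_f0.
  by apply: (dvdp_trinomial_Xn_sub1 (b := b) (c := c)) => //; rewrite -n2k -ik.
- case=> k [a [[k_gt0 n2k ik] [gE _ a2 _]]].
  rewrite /C; subst n; rewrite gE in hgf *.
  exact: half_code_self_dual.
case/sd_form=> k [a [k_gt0 n2k ik gE a2]].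
rewrite /C; subst n; rewrite gE in hgf *.
by split; [apply: half_code_min_distance | apply: half_code_constacyclic].
Qed.
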